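(* Let $(X,\preceq)$ be a partially ordered set and $d$ a metric on $X$ such that $(X,d)$ is complete. Let $f,g:X\to X$ be such that $f(X)\subseteq g(X)$ and $f$ is $g$-non-decreasing with respect to $\preceq$. Suppose that there exists a function $\psi\in\Psi$ such that $$d(fx,fy)\le\psi\left(\max\left\{d(gx,gy),\frac{d(gx,fx)+d(gy,fy)}{2},\frac{d(gx,fy)+d(gy,fx)}{2}\right\}\right)$$ for all $x,y\in X$ with $gx\preceq gy$. Suppose also that: (i) there exists $x_0\in X$ such that $gx_0\preceq fx_0$; (ii) $(X,\preceq,d)$ is $g$-regular. Also suppose that $g(X)$ is closed. Then $f$ and $g$ have a coincidence point. Moreover, if for every pair $(x,y)\in C(g,f)\times C(g,f)$ there exists $z\in X$ such that $gx\preceq gz$ and $gy\preceq gz$, and if $f$ and $g$ commute at their coincidence points, then $f$ and $g$ have a unique common fixed point.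
   Context: $\Psi$ denotes the family of functions $\psi:[0,\infty)\to[0,\infty)$ that are nondecreasing and satisfy $\sum_{n=1}^{+\infty}\psi^n(t)<\infty$ for all $t>0$, where $\psi^n$ is the $n$-th iterate of $\psi$. Notation: $fx=f(x)$, $gx=g(x)$. A coincidence point of $f$ and $g$ is $z\in X$ with $fz=gz$; $C(g,f)=\{z\in X: gz=fz\}$. A common fixed point is $z\in X$ with $fz=gz=z$. ''$f$ and $g$ commute at their coincidence points'' means $f(g(x))=g(f(x))$ for all $x\in C(g,f)$. $f$ is $g$-non-decreasing with respect to $\preceq$ if for all $x,y\in X$, $gx\preceq gy$ implies $fx\preceq fy$. $(X,\preceq,d)$ is $g$-regular if for every nondecreasing sequence $\{gx_n\}\subset X$ (i.e. $gx_n\preceq gx_{n+1}$ for all $n$) such that $gx_n\to gz\in X$ as $n\to\infty$, there exists a subsequence $\{gx_{n(k)}\}$ of $\{gx_n\}$ such that $gx_{n(k)}\preceq gz$ for all $k$. *)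

(* Defs.v *)
From HB Require Import structures.
From mathcomp Require Import all_boot all_order all_algebra.
From mathcomp Require Import all_classical all_reals.
From mathcomp Require Import topology ereal normedtype sequences.

Set Implicit Arguments.
Unset Strict Implicit.
Unset Printing Implicit Defensive.

Import Order.TTheory GRing.Theory Num.Theory.
Import numFieldNormedType.Exports.

Local Open Scope classical_set_scope.
Local Open Scope ring_scope.

(* The order and the metric topology are unrelated. *)
#[short(type="pcompleteMetricType")]
HB.structure Definition POrderedCompleteMetric d (R : numDomainType) :=
  { X of Order.POrder d X & Complete X & Metric R X }.

(* A function [0, +oo) -> [0, +oo) is represented by psi : R -> R mapping
   nonnegative reals to nonnegative reals; its values at negative arguments
   are unconstrained. *)
Definition Psi (R : realType) : set (R -> R) :=
  [set psi : R -> R |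
    [/\ {homo psi : t / 0 <= t},
        {in >= 0 &, {homo psi : s t / s <= t}} &
        forall t : R, 0 < t ->
          (\sum_(1 <= n <oo) (iter n psi t)%:E < +oo)%E]].

Definition coincidence_set (X : Type) (g f : X -> X) : set X :=
  [set z | g z = f z].

Definition common_fixed_point (X : Type) (f g : X -> X) (z : X) : Prop :=
  f z = g z /\ g z = z.

Definition commute_at_coincidences (X : Type) (f g : X -> X) : Prop :=
  forall x, coincidence_set g f x -> f (g x) = g (f x).

Definition g_nondecreasing d (X : porderType d) (g f : X -> X) : Prop :=
  forall x y, (g x <= g y)%O -> (f x <= f y)%O.

Definition g_regular d (R : realType) (X : pcompleteMetricType d R)
    (g : X -> X) : Prop :=
  forall (x : nat -> X) (z : X),
    (forall n, (g (x n) <= g (x n.+1))%O) ->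
    g (x n) @[n --> \oo] --> g z ->
    exists2 k : nat -> nat, {homo k : m n / (m < n)%N} &
      forall n, (g (x (k n)) <= g z)%O.

(* Main.v *)
Require Import Defs.
From mathcomp Require Import all_boot all_order all_algebra.
From mathcomp Require Import all_classical all_reals.
From mathcomp Require Import topology ereal normedtype sequences.
From mathcomp Require Import lra.

Set Implicit Arguments.
Unset Strict Implicit.
Unset Printing Implicit Defensive.

Import Order.TTheory GRing.Theory Num.Theory.
Import numFieldNormedType.Exports.

Local Open Scope classical_set_scope.
Local Open Scope ring_scope.

(** The proof runs the Jungck iteration [g (x n.+1) = f (x n)] twice.  In both
    runs a sequence [a] of distances satisfies
    [a n.+1 <= psi (Num.max (a n) (a n.+1))].  As [psi t < t] for [t > 0], the
    maximum has to be [a n], so [a n <= iter n psi (a 0)] and the series of [a]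
    converges ([Psi_recursion_summable]).

    Existence.  Start from [g x0 <= f x0] and take
    [a n = mdist (g (x n)) (g (x n.+1))].  Summability makes [g \o x] a Cauchy
    sequence; its limit lies in the closed range of [g], so it is some [g z].
    By regularity, infinitely many [g (x n)] lie below [g z], and the
    contraction can be applied to [x n] and [z].  Its bound tends to
    [mdist (g z) (f z) / 2] whereas its left-hand side tends to
    [mdist (g z) (f z)].  This factor one half is what spares any continuity of
    [psi]: if [D = mdist (g z) (f z)] were positive, [psi (3 * D / 4) < 3 * D / 4]
    would already be contradicted ([coincidence_of_limit]).

    Uniqueness.  Let [x] and [y] be coincidence points with [g x] and [g y]
    below [g z].  Start an iteration [u] from [z] and take
    [a n = mdist (g x) (g (u n))]: it tends to [0], so [g \o u] converges to
    [g x], and for the same reason to [g y] ([cvg_to_coincidence_value]).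
    Hence [g] takes a single value [w] on coincidence points; commutation makes
    [w] itself a coincidence point, so [g w = w]. *)

(** * Summable sequences *)

(** The summation range starts at [1] because the classical condition on
    comparison functions concerns the proper iterates only. *)
Lemma summable_tail_lt (R : realType) (u : nat -> R) (e : R) :
  (forall n, 0 <= u n) -> (\sum_(1 <= n <oo) (u n)%:E < +oo)%E -> 0 < e ->
  exists N, forall n, \sum_(N <= k < n) u k < e.
Proof.
move=> u0 usum e0.
have uE0 n : (0%R <= (u n)%:E)%E by rewrite lee_fin.
rewrite -(nneseries_addn 1 uE0) in usum.
have /fine_cvgP[[N1 _ finN] /cvgrPdist_lt/(_ e e0)[N2 _ ltN]] :=
  nneseries_tail_cvg usum (fun k _ => uE0 (k + 1)%N).
(* [usum] has been shifted by one: its tail from [N] is that of [u] from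
   [N.+1]. *)
set N := maxn N1 N2; exists N.+1 => n.
have := ltN N (leq_maxr _ _); have := finN N (leq_maxl _ _).
rewrite /= sub0r normrN; set S := limn _ => Sfin Slt.
apply: le_lt_trans (le_lt_trans (ler_norm _) Slt).
rewrite -lee_fin fineK// -sumEFin.
apply: le_trans (nneseries_lim_ge n.-1 (fun k _ _ => uE0 (k + 1)%N)).
case: n => [|n]; first by rewrite big_geq// sume_ge0.
by rewrite big_add1; apply: lee_sum => k _; rewrite addn1.
Qed.

Lemma summable_cvg0 (R : realType) (u : nat -> R) :
  (forall n, 0 <= u n) -> (\sum_(1 <= n <oo) (u n)%:E < +oo)%E ->
  u n @[n --> \oo] --> 0.
Proof.
move=> u0 usum; apply/cvgrPdist_lt => e e0.
have [N tailN] := summable_tail_lt u0 usum e0.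
near=> n; rewrite sub0r normrN ger0_norm//.
have Nn : (N <= n)%N by near: n; exists N.
apply: le_lt_trans (tailN n.+1).
by rewrite big_nat_recr//= lerDr sumr_ge0.
Unshelve. all: by end_near. Qed.

Lemma mdist_le_sum (R : realType) (T : metricType R) (y : nat -> T) m n :
  (m <= n)%N ->
  mdist (y m) (y n) <= \sum_(m <= k < n) mdist (y k) (y k.+1).
Proof.
elim: n => [|n IHn]; first by rewrite leqn0 => /eqP->; rewrite mdistxx big_geq.
rewrite leq_eqVlt => /predU1P[->|]; first by rewrite mdistxx big_geq.
rewrite ltnS => mn; rewrite big_nat_recr//=.
by apply: le_trans (metric_triangle _ (y n) _) _; rewrite lerD2r IHn.
Qed.

(** The tail from [N] of the series of consecutive distances bounds the distance
    from [y N] to all later terms at once, so [y N] can serve as the centre of a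
    small ball that contains a tail of the sequence. *)
Lemma summable_cauchy (R : realType) (T : metricType R) (y : nat -> T) :
  (\sum_(1 <= n <oo) (mdist (y n) (y n.+1))%:E < +oo)%E ->
  cauchy (y n @[n --> \oo]).
Proof.
move=> ysum; apply: cauchy_exP => e e0.
have [N tailN] := summable_tail_lt (fun n => mdist_ge0 (y n) (y n.+1)) ysum e0.
exists (y N); exists N => // n /= Nn.
by rewrite ballEmdist /=; apply: le_lt_trans (tailN n); exact: mdist_le_sum.
Qed.

(** * Comparison functions *)

Section comparison_function.
Context (R : realType) (psi : R -> R) (psiP : Psi psi).

Lemma Psi_ge0 t : 0 <= t -> 0 <= psi t.
Proof. by case: psiP => + _ _; apply. Qed.

Lemma Psi_le s t : 0 <= s -> s <= t -> psi s <= psi t.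
Proof.
by case: psiP => _ + _ => mono s0 st; apply: mono => //; apply: le_trans st.
Qed.

Lemma Psi_iter_ge0 n t : 0 <= t -> 0 <= iter n psi t.
Proof. by move=> t0; elim: n => //= n; exact: Psi_ge0. Qed.

(** Otherwise every iterate at [t] is at least [t], and the series of iterates
    diverges. *)
Lemma Psi_lt t : 0 < t -> psi t < t.
Proof.
move=> t0; rewrite ltNge; apply/negP => tpsi.
have iter_ge n : t <= iter n psi t.
  elim: n => //= n IHn; apply: le_trans tpsi _.
  by apply: Psi_le => //; exact: ltW.
have [_ _ /(_ t t0) tsum] := psiP.
have /cvgrPdist_lt/(_ t t0)[N _ /(_ N (leqnn N))] :=
  summable_cvg0 (fun n => Psi_iter_ge0 n (ltW t0)) tsum.
by rewrite /= sub0r normrN ger0_norm ?ltNge ?iter_ge// Psi_iter_ge0// ltW.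
Qed.

Lemma Psi0 : psi 0 = 0.
Proof.
apply/eqP; rewrite eq_le Psi_ge0// andbT leNgt; apply/negP => psi0.
by have := Psi_lt psi0; rewrite ltNge Psi_le// ltW.
Qed.

Lemma Psi_summable t : 0 <= t -> (\sum_(1 <= n <oo) (iter n psi t)%:E < +oo)%E.
Proof.
rewrite le_eqVlt => /predU1P[<-|]; last by case: psiP => _ _; apply.
rewrite eseries0 ?ltry// => n _ _.
by congr (_%:E); elim: n => //= n ->; exact: Psi0.
Qed.

(** If the maximum were [b > a], then [b <= psi b < b]. *)
Lemma Psi_max_le a b : 0 <= a -> b <= psi (Num.max a b) -> b <= psi a.
Proof.
move=> a0; case: (leP b a) => // ab bpsi.
by have := Psi_lt (le_lt_trans a0 ab); rewrite ltNge bpsi.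
Qed.

(** This is the form in which both contraction estimates are used: the recursion
    is implicit in [a n.+1], and [Psi_max_le] makes it explicit. *)
Lemma Psi_recursion_summable (a : nat -> R) :
  (forall n, 0 <= a n) ->
  (forall n, a n.+1 <= psi (Num.max (a n) (a n.+1))) ->
  (\sum_(1 <= n <oo) (a n)%:E < +oo)%E.
Proof.
move=> a0 a_rec; apply: le_lt_trans (Psi_summable (a0 0)).
apply: lee_nneseries => n _; rewrite lee_fin//.
elim: n => //= n IHn; apply: le_trans (Psi_max_le (a0 n) (a_rec n)) _.
exact: Psi_le.
Qed.

End comparison_function.

(** * The Jungck iteration *)

Lemma jungck_seq (X : Type) (f g : X -> X) (x0 : X) :
  range f `<=` range g ->
  exists2 x : nat -> X, x 0%N = x0 & forall n, g (x n.+1) = f (x n).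
Proof.
move=> fg; have /choice[h hE] : forall y, exists x, g x = f y.
  by move=> y; have [x _ gxfy] := fg (f y) (imageT f y); exists x.
by exists (fun n => iter n h x0) => // n; rewrite /= hE.
Qed.

Section contraction.
Context (d : Order.disp_t) (R : realType) (X : pcompleteMetricType d R).
Context (f g : X -> X) (f_mono : g_nondecreasing g f).

Definition ciric_max (x y : X) : R :=
  Num.max (mdist (g x) (g y))
    (Num.max ((mdist (g x) (f x) + mdist (g y) (f y)) / 2)
             ((mdist (g x) (f y) + mdist (g y) (f x)) / 2)).

Context (psi : R -> R) (psiP : Psi psi).
Context (f_contr : forall x y : X, (g x <= g y)%O ->
  mdist (f x) (f y) <= psi (ciric_max x y)).

Lemma ciric_max_ge0 x y : 0 <= ciric_max x y.
Proof. by rewrite /ciric_max le_max mdist_ge0. Qed.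

Lemma contr_le x y c :
  (g x <= g y)%O -> ciric_max x y <= c -> mdist (f x) (f y) <= psi c.
Proof.
move=> gxy Mc; apply: le_trans (f_contr gxy) _.
by apply: Psi_le => //; exact: ciric_max_ge0.
Qed.

Section iteration.
Context (x : nat -> X) (gx : forall n, g (x n.+1) = f (x n)).

Lemma jungck_nondecreasing :
  (g (x 0) <= f (x 0))%O -> forall n, (g (x n) <= g (x n.+1))%O.
Proof.
by move=> x0; elim=> [|n IHn]; rewrite gx// gx; exact: f_mono.
Qed.

(** With [y n = g (x n)], the crossed term of the contraction is half of
    [mdist (y n) (y n.+2)], which the triangle inequality bounds by the mean of
    the two consecutive distances. *)
Lemma jungck_dist_recursion n : (g (x n) <= g (x n.+1))%O ->
  mdist (g (x n.+1)) (g (x n.+2)) <=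
  psi (Num.max (mdist (g (x n)) (g (x n.+1)))
               (mdist (g (x n.+1)) (g (x n.+2)))).
Proof.
move=> le_n; rewrite [g (x n.+2)]gx {1}[g (x n.+1)]gx; apply: contr_le => //.
rewrite /ciric_max -!gx mdistxx.
have := metric_triangle (g (x n)) (g (x n.+1)) (g (x n.+2)).
set a := mdist _ (g (x n.+1)); set b := mdist _ (g (x n.+2)).
have am : a <= Num.max a b by rewrite le_max lexx.
have bm : b <= Num.max a b by rewrite le_max lexx orbT.
by rewrite !ge_max => ?; apply/and3P; split; lra.
Qed.

Lemma jungck_cauchy :
  (g (x 0) <= f (x 0))%O -> cauchy (g (x n) @[n --> \oo]).
Proof.
move=> x0; apply: summable_cauchy.
apply: (Psi_recursion_summable psiP) => n; first exact: mdist_ge0.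
exact/jungck_dist_recursion/jungck_nondecreasing.
Qed.

(** If [f z] differed from [g z], a single term that is comparable to [g z] and
    close enough to it would give a contradiction; comparability at arbitrarily
    late indices provides one. *)
Lemma coincidence_of_limit (z : X) :
  g (x n) @[n --> \oo] --> g z ->
  (forall N, exists2 n, (N <= n)%N & (g (x n) <= g z)%O) ->
  f z = g z.
Proof.
move=> gxz below; apply/eqP; rewrite eq_sym -[_ == _]negbK -mdist_gt0.
apply/negP => D0; set D := mdist _ _ in D0.
(* With errors below [D / 4] the three terms of the maximum are at most [D / 4],
   [3 * D / 4] and [3 * D / 4], and [mdist (f (x n)) (f z) >= 3 * D / 4]. *)
have e0 : 0 < D / 4 by lra.
have [N _ close] := metricType_numDomainType.cvgr_dist_lt gxz e0.
have [n Nn le_z] := below N.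
have := close n Nn; have := close n.+1 (leqW Nn); rewrite /= gx => hf hg.
have Mle : ciric_max (x n) z <= 3 * D / 4.
  have t1 := metric_triangle (g (x n)) (g z) (f (x n)).
  have t2 := metric_triangle (g (x n)) (g z) (f z).
  rewrite /ciric_max !ge_max -/D; rewrite (metric_sym (g (x n)) (g z)) in t1 t2 *.
  by rewrite -/D in t2; apply/and3P; split; lra.
have := contr_le le_z Mle.
have D34 : 0 < 3 * D / 4 by lra.
have := Psi_lt psiP D34.
have := metric_triangle (g z) (f (x n)) (f z); rewrite -/D.
lra.
Qed.

End iteration.

(** A coincidence value [g p] below the start stays below the whole iteration,
    since [f p = g p]; the contraction then applies to [p] and every [x n]. *)
Lemma cvg_to_coincidence_value (x : nat -> X) (p : X) :
  (forall n, g (x n.+1) = f (x n)) -> g p = f p -> (g p <= g (x 0))%O ->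
  g (x n) @[n --> \oo] --> g p.
Proof.
move=> gx gfp le0.
have le_n n : (g p <= g (x n))%O.
  by elim: n => // n; rewrite gx {2}gfp; exact: f_mono.
pose a n := mdist (g p) (g (x n)).
have a0 n : 0 <= a n by exact: mdist_ge0.
have a_rec n : a n.+1 <= psi (Num.max (a n) (a n.+1)).
  rewrite /a {1}gfp {1}gx; apply: contr_le => //.
  rewrite /ciric_max -gfp -gx mdistxx.
  have := metric_triangle (g (x n)) (g p) (g (x n.+1)).
  rewrite (metric_sym (g (x n)) (g p)) -/(a n) -/(a n.+1).
  have am : a n <= Num.max (a n) (a n.+1) by rewrite le_max lexx.
  have bm : a n.+1 <= Num.max (a n) (a n.+1) by rewrite le_max lexx orbT.
  by rewrite !ge_max => ?; apply/and3P; split; lra.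
have /cvgrPdist_lt acvg :=
  summable_cvg0 a0 (Psi_recursion_summable psiP a0 a_rec).
apply/metricType_numDomainType.cvgrPdist_lt => e /acvg.
by apply: filterS => n; rewrite sub0r normrN ger0_norm.
Qed.

End contraction.

(** * Coincidence and common fixed points *)

Theorem corollary4p10 (d : Order.disp_t) (R : realType)
    (X : pcompleteMetricType d R) (f g : X -> X)
    (fXgX : range f `<=` range g)
    (f_mono : g_nondecreasing g f)
    (f_contr : exists2 psi : R -> R, Psi psi &
      forall x y : X, (g x <= g y)%O ->
        mdist (f x) (f y) <=
        psi (Num.max (mdist (g x) (g y))
            (Num.max ((mdist (g x) (f x) + mdist (g y) (f y)) / 2)
                     ((mdist (g x) (f y) + mdist (g y) (f x)) / 2))))
    (f_start : exists x0 : X, (g x0 <= f x0)%O)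
    (X_reg : g_regular g)
    (gX_closed : closed (range g)) :
  (exists z : X, f z = g z) /\
  ((forall x y : X, coincidence_set g f x -> coincidence_set g f y ->
      exists z : X, (g x <= g z)%O /\ (g y <= g z)%O) ->
   commute_at_coincidences f g ->
   exists! z : X, common_fixed_point f g z).
Proof.
case: f_contr => psi psiP contr.
have coincidence : exists z : X, f z = g z.
  have [x0 x0P] := f_start.
  have [x xE gx] := jungck_seq x0 fXgX.
  have start : (g (x 0) <= f (x 0))%O by rewrite xE.
  have /cauchy_cvg/cvg_ex[l gxl] := jungck_cauchy f_mono psiP contr gx start.
  have [z _ zl] : range g l.
    by apply: (closed_cvg _ gX_closed _ _ gxl); apply: nearW => n; exists (x n).
  rewrite -zl in gxl.
  have [k k_mono k_le] := X_reg x z (jungck_nondecreasing f_mono gx start) gxl.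
  exists z; apply: (coincidence_of_limit psiP contr gx gxl) => N.
  exists (k N) => //; elim: N => // N IHN.
  exact: leq_ltn_trans IHN (k_mono _ _ (ltnSn N)).
split=> // directed fgC.
have value_unique x y : g x = f x -> g y = f y -> g x = g y.
  move=> gfx gfy; have [z [xz yz]] := directed x y gfx gfy.
  have [u uE gu] := jungck_seq z fXgX.
  have cvg_val p : g p = f p -> (g p <= g z)%O -> g (u n) @[n --> \oo] --> g p.
    move=> gfp pz; apply: (cvg_to_coincidence_value f_mono psiP contr) => //.
    by rewrite uE.
  exact: (cvg_unique (@metric_hausdorff _ X)
                     (cvg_val x gfx xz) (cvg_val y gfy yz)).
have [z fgz] := coincidence.
have gfw : g (g z) = f (g z) by rewrite fgC// fgz.
exists (g z); split=> [|w [fgw gw]].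
  by split; rewrite -?gfw//; exact: value_unique.
by rewrite -gw; exact: value_unique.
Qed.
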